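(* For all $x,y\in\mathbb{H}^n$ we have $$\rho_{\mathbb{H}^n}(x,y)\le u_{\mathbb{H}^n}(x,y).$$ The inequality is sharp, i.e. there is no constant $C<1$ such that $\rho_{\mathbb{H}^n}(x,y)\le C\,u_{\mathbb{H}^n}(x,y)$ for all $x,y\in\mathbb{H}^n$.
   Context: Here $n\ge2$ and $\mathbb{H}^n=\{(x_1,\dots,x_n)\in\mathbb{R}^n: x_n>0\}$ is the upper half space. Its hyperbolic metric $\rho_{\mathbb{H}^n}$ is given by $2\sinh\left(\frac{\rho_{\mathbb{H}^n}(x,y)}{2}\right)=\frac{|x-y|}{\sqrt{x_ny_n}}$. For a domain (open connected set) $D\subsetneq\mathbb{R}^n$, write $d(x)=\mathrm{dist}(x,\partial D)$ and define $u_D(x,y)=2\log\frac{|x-y|+\max\{d(x),d(y)\}}{\sqrt{d(x)d(y)}}$ for $x,y\in D$; for $D=\mathbb{H}^n$ one has $d(x)=x_n$. *)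

(* Defs.v *)
From HB Require Import structures.
From mathcomp Require Import all_boot all_order all_algebra.
From mathcomp Require Import all_classical all_reals all_analysis.
From mathcomp Require Import ring lra.
Set Implicit Arguments.
Unset Strict Implicit.
Unset Printing Implicit Defensive.
Import Order.TTheory GRing.Theory Num.Theory.
Import numFieldNormedType.Exports.
Local Open Scope classical_set_scope.
Local Open Scope ring_scope.

(* The library norm on row vectors is the sup norm. It induces the Euclidean
   topology, so [closure] and [interior] below have their usual meaning. *)
Definition enorm (R : realType) (n : nat) (x : 'rV[R]_n) : R :=
  Num.sqrt (\sum_(i < n) x ord0 i ^+ 2).

Definition boundary (T : topologicalType) (D : set T) : set T :=
  closure D `\` interior D.

Definition bdist (R : realType) (n : nat) (D : set 'rV[R]_n) (x : 'rV[R]_n)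
    : R :=
  inf [set enorm (x - z) | z in boundary D].

(* Meant for a domain D different from the whole space and points x, y of D;
   bdist D x and bdist D y are then positive. *)
Definition u_metric (R : realType) (n : nat) (D : set 'rV[R]_n)
    (x y : 'rV[R]_n) : R :=
  2 * ln ((enorm (x - y) + Num.max (bdist D x) (bdist D y))
          / Num.sqrt (bdist D x * bdist D y)).

(* The dimension is n.+1, so that the last coordinate is at index ord_max. *)
Definition upper_half_space (R : realType) (n : nat) : set 'rV[R]_n.+1 :=
  [set x | 0 < x ord0 ord_max].

Definition sinh (R : realType) (x : R) : R := (expR x - expR (- x)) / 2.

(* The unique solution of the defining equation, by rho_half_spaceP and
   rho_half_space_unique. *)
Definition rho_half_space (R : realType) (n : nat) (x y : 'rV[R]_n.+1) : R :=
  get [set r : R | 2 * sinh (r / 2)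
                   = enorm (x - y)
                     / Num.sqrt (x ord0 ord_max * y ord0 ord_max)].

Lemma sinh_inj (R : realType) : injective (@sinh R).
Proof.
have sinh_lt (a b : R) : a < b -> sinh a < sinh b.
  move=> ab; rewrite /sinh ltr_pM2r ?invr_gt0 ?ltr0n //.
  by apply: ltrB; rewrite ltr_expR ?ltrN2.
move=> a b eab; have [/sinh_lt|/sinh_lt|//] := ltgtP a b;
  by rewrite eab ltxx.
Qed.

Lemma sinh_surj (R : realType) (t : R) : exists r : R, sinh r = t.
Proof.
set s := Num.sqrt (t ^+ 2 + 1).
have s2 : s ^+ 2 = t ^+ 2 + 1 by rewrite sqr_sqrtr// addr_ge0// sqr_ge0.
have s0 : 0 <= s by exact: sqrtr_ge0.
have ts : 0 < t + s by nra.
exists (ln (t + s)); rewrite /sinh expRN lnK ?posrE//.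
have -> : (t + s)^-1 = s - t.
  apply: (mulfI (lt0r_neq0 ts)); rewrite divff ?lt0r_neq0//.
  by rewrite -[LHS](addrK (t ^+ 2)) [1 + _]addrC -s2; ring.
by field.
Qed.

Lemma rho_half_spaceP (R : realType) (n : nat) (x y : 'rV[R]_n.+1) :
  2 * sinh (rho_half_space x y / 2)
  = enorm (x - y) / Num.sqrt (x ord0 ord_max * y ord0 ord_max).
Proof.
rewrite /rho_half_space; set c := (X in _ = X).
have [r hr] := sinh_surj (c / 2).
apply: (@getI _ [set r : R | 2 * sinh (r / 2) = c] (2 * r)) => /=.
by rewrite [2 * r]mulrC mulfK ?pnatr_eq0// hr mulrC divfK ?pnatr_eq0.
Qed.

Lemma rho_half_space_unique (R : realType) (n : nat) (x y : 'rV[R]_n.+1)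
    (r : R) :
  2 * sinh (r / 2)
  = enorm (x - y) / Num.sqrt (x ord0 ord_max * y ord0 ord_max) ->
  rho_half_space x y = r.
Proof.
have two0 : (2 : R) != 0 by rewrite pnatr_eq0.
rewrite -rho_half_spaceP => /(mulfI two0)/(@sinh_inj R).
by move=> /(mulIf (invr_neq0 two0)).
Qed.

(* Main.v *)
(** The boundary of the half space is [x_n = 0], so [d(x) = x_n].  Write
    [c = |x - y|], [M = max(x_n, y_n)], [g^2 = x_n y_n] and [t = (c + M) / g],
    so that [u = 2 ln t].  Since sinh is increasing, [rho <= u] amounts to
    [c / g <= t - 1 / t], that is, to [g^2 <= M (c + M)].

    For sharpness take two points on a vertical line at heights [1] and
    [exp (2 k)]: then [rho = 2 k] while [u <= 2 k + 2 ln 2], and the ratio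
    tends to [1] as [k] grows. *)

Require Import Defs.
From HB Require Import structures.
From mathcomp Require Import all_boot all_order all_algebra.
From mathcomp Require Import all_classical all_reals all_analysis.
From mathcomp Require Import ring lra.
Import Order.TTheory GRing.Theory Num.Theory.
Import numFieldNormedType.Exports.
Local Open Scope classical_set_scope.
Local Open Scope ring_scope.

Lemma ler_sinh (R : realType) : {mono @sinh R : x y / x <= y}.
Proof.
apply: le_mono => x y xy; rewrite /sinh ltr_pM2r ?invr_gt0 ?ltr0n//.
by apply: ltrB; rewrite ltr_expR ?ltrN2.
Qed.

Lemma sinh_ln (R : realType) (t : R) : 0 < t -> sinh (ln t) = (t - t^-1) / 2.
Proof. by move=> t0; rewrite /sinh expRN lnK ?posrE. Qed.

Lemma enorm_ge0 (R : realType) (n : nat) (x : 'rV[R]_n) : 0 <= enorm x.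
Proof. exact: sqrtr_ge0. Qed.

Lemma normr_coord_le_enorm (R : realType) (n : nat) (x : 'rV[R]_n) (i : 'I_n) :
  `|x ord0 i| <= enorm x.
Proof.
rewrite -sqrtr_sqr /enorm ler_wsqrtr// (bigD1 i)//= lerDl.
by apply: sumr_ge0 => j _; exact: sqr_ge0.
Qed.

Lemma enorm_axis (R : realType) (n : nat) (a : R) (i : 'I_n) :
  enorm (a *: delta_mx ord0 i) = `|a|.
Proof.
rewrite /enorm (bigD1 i)//= big1 => [|j /negPf ji].
  by rewrite !mxE !eqxx mulr1 addr0 sqrtr_sqr.
by rewrite !mxE ji andbF mulr0 expr0n.
Qed.

Lemma open_upper_half_space (R : realType) (n : nat) :
  open (@upper_half_space R n).
Proof.
apply: (@open_comp _ _ (fun x : 'rV[R]_n.+1 => x ord0 ord_max) [set r | 0 < r]).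
  by move=> x _; exact: coord_continuous.
exact: open_gt.
Qed.

Lemma closure_upper_half_space (R : realType) (n : nat) :
  closure (@upper_half_space R n) = [set x | 0 <= x ord0 ord_max].
Proof.
apply/seteqP; split.
  have cl : closed [set x : 'rV[R]_n.+1 | 0 <= x ord0 ord_max].
    apply: (@preimage_closed _ _ (fun x : 'rV[R]_n.+1 => x ord0 ord_max)
      [set r | 0 <= r]); last exact: closed_ge.
    by move=> x _; exact: coord_continuous.
  by rewrite closureE; apply: smallest_sub => // x /ltW.
move=> x /= x0 B /nbhs_ballP[e /= e0 eB].
(* A shift by [e / 2] along the last axis makes the last coordinate positive. It stays in the ball
   of radius [e], which is taken coordinatewise: each coordinate moves by [e / 2] or not at all. *)
exists (x + (e / 2) *: delta_mx ord0 ord_max); split.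
  rewrite /upper_half_space /= !mxE !eqxx mulr1.
  by rewrite ltr_wpDl// divr_gt0.
apply: eB; split => // i j; rewrite /ball /= !mxE.
rewrite opprD addNKr normrN.
case: ((i == _) && (j == _)).
  by rewrite mulr1 ger0_norm; lra.
by rewrite mulr0 normr0.
Qed.

Lemma boundary_upper_half_space (R : realType) (n : nat) :
  boundary (@upper_half_space R n) = [set x | x ord0 ord_max = 0].
Proof.
rewrite /boundary closure_upper_half_space.
have /interior_id -> := @open_upper_half_space R n.
apply/seteqP; split => x /=; rewrite /upper_half_space /=.
  by move=> [x0 /negP]; rewrite -leNgt => x1; apply/eqP; rewrite eq_le x0 x1.
by move=> ->; rewrite ltxx lexx.
Qed.

(** The infimum is a minimum, attained at the orthogonal projection of [x] to the hyperplane. Any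
    boundary point differs from [x] by [x ord0 ord_max] in the last coordinate alone, and a
    coordinate never exceeds the Euclidean norm. *)
Lemma bdist_upper_half_space (R : realType) (n : nat) (x : 'rV[R]_n.+1) :
  upper_half_space x -> bdist (@upper_half_space R n) x = x ord0 ord_max.
Proof.
rewrite /upper_half_space /= => x0; rewrite /bdist boundary_upper_half_space.
set A := (X in inf X).
have Ax : A (x ord0 ord_max).
  exists (x - x ord0 ord_max *: delta_mx ord0 ord_max).
    by rewrite /= !mxE !eqxx mulr1 subrr.
  by rewrite subKr enorm_axis gtr0_norm.
have lbA : lbound A (x ord0 ord_max).
  move=> _ [z /= z0 <-]; apply: le_trans (normr_coord_le_enorm _ _ _ ord_max).
  by rewrite !mxE z0 subr0 ler_norm.
apply/eqP; rewrite eq_le lb_le_inf ?andbT//; last by exists (x ord0 ord_max).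
by apply: ge_inf Ax; exists (x ord0 ord_max).
Qed.

Lemma u_metric_upper_half_space (R : realType) (n : nat) (x y : 'rV[R]_n.+1) :
  upper_half_space x -> upper_half_space y ->
  u_metric (@upper_half_space R n) x y =
  2 * ln ((enorm (x - y) + Num.max (x ord0 ord_max) (y ord0 ord_max))
          / Num.sqrt (x ord0 ord_max * y ord0 ord_max)).
Proof. by move=> hx hy; rewrite /u_metric !bdist_upper_half_space. Qed.

Lemma rho_le_u_half_space (R : realType) (n : nat) (x y : 'rV[R]_n.+1) :
  upper_half_space x -> upper_half_space y ->
  rho_half_space x y <= u_metric (@upper_half_space R n) x y.
Proof.
move=> hx hy; rewrite u_metric_upper_half_space//.
have := rho_half_spaceP x y; have := enorm_ge0 _ _ (x - y).
move: hx hy; rewrite /upper_half_space /=.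
set a := x ord0 _; set b := y ord0 _; set c := enorm _; set g := Num.sqrt _.
set M := Num.max _ _; set t := (c + M) / g => a0 b0 c0 rhoE.
have g0 : 0 < g by rewrite sqrtr_gt0 mulr_gt0.
(* Here [g ^+ 2 = a * b], with [a <= M] and [b <= M <= c + M]. *)
have gM : g ^+ 2 <= M * (c + M).
  rewrite sqr_sqrtr; last by rewrite mulr_ge0 ?ltW.
  by rewrite ler_pM ?(ltW a0) ?(ltW b0) ?ler_wpDl// le_max lexx ?orbT.
have cM0 : 0 < c + M by rewrite ltr_wpDl// lt_max a0.
have t0 : 0 < t by rewrite divr_gt0.
rewrite mulrC -ler_pdivrMr// -ler_sinh sinh_ln// ler_pdivlMr// mulrC rhoE.
(* The excess of [t - t^-1] over [c / g] is a fraction whose numerator is the slack in [gM]. *)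
have -> : t - t^-1 = c / g + (M * (c + M) - g ^+ 2) / (g * (c + M)).
  by rewrite /t; field; rewrite !gt_eqF.
by rewrite lerDl divr_ge0 ?subr_ge0// mulr_ge0 ?ltW.
Qed.

Lemma upper_half_space_axis (R : realType) (n : nat) (a : R) :
  0 < a -> @upper_half_space R n (a *: delta_mx ord0 ord_max).
Proof. by move=> a0; rewrite /upper_half_space /= !mxE !eqxx mulr1. Qed.

Section vertical_line.
Variables (R : realType) (n : nat) (k : R).
Hypothesis k0 : 0 <= k.

(** The height is a square so that the geometric mean of the two heights is [expR k]. *)
Let x : 'rV[R]_n.+1 := expR k ^+ 2 *: delta_mx ord0 ord_max.
Let y : 'rV[R]_n.+1 := 1 *: delta_mx ord0 ord_max.

Let e1 : 1 <= expR k. Proof. by rewrite -expR0 ler_expR. Qed.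

Let xE : x ord0 ord_max = expR k ^+ 2.
Proof. by rewrite !mxE !eqxx mulr1. Qed.

Let yE : y ord0 ord_max = 1.
Proof. by rewrite !mxE !eqxx mulr1. Qed.

Let sqrt_xyE : Num.sqrt (x ord0 ord_max * y ord0 ord_max) = expR k.
Proof. by rewrite xE yE mulr1 sqrtr_sqr ger0_norm// expR_ge0. Qed.

Let enorm_xyE : enorm (x - y) = expR k ^+ 2 - 1.
Proof. by rewrite -scalerBl enorm_axis ger0_norm// subr_ge0 exprn_ege1. Qed.

(** With [E = expR k], the defining quotient is [(E ^+ 2 - 1) / E = E - E^-1], which is
    [2 * sinh k]. *)
Lemma rho_vertical : rho_half_space x y = 2 * k.
Proof.
apply: rho_half_space_unique; rewrite sqrt_xyE enorm_xyE.
rewrite [2 * k]mulrC mulfK ?pnatr_eq0// /sinh expRN.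
by field; rewrite gt_eqF ?expR_gt0.
Qed.

(** With [E = expR k], the argument of the logarithm is [(2 * E ^+ 2 - 1) / E], which is at most
    [2 * E]. *)
Lemma u_vertical_le :
  u_metric (@upper_half_space R n) x y <= 2 * (k + ln 2).
Proof.
have E0 := expR_gt0 k.
rewrite u_metric_upper_half_space; last 2 first.
- by apply: upper_half_space_axis; rewrite exprn_gt0.
- exact: upper_half_space_axis.
rewrite sqrt_xyE enorm_xyE xE yE max_l ?exprn_ege1//.
rewrite ler_pM2l// -[k in X in _ <= X]expRK -lnM ?posrE//.
have E2 : 1 <= expR k ^+ 2 by rewrite exprn_ege1.
rewrite ler_ln ?posrE; [|by rewrite divr_gt0//; lra|by rewrite mulr_gt0].
by rewrite ler_pdivrMr//; nra.
Qed.

End vertical_line.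

Theorem theorem3p6 (R : realType) (n : nat) (hn : (2 <= n.+1)%N) :
  (forall x y : 'rV[R]_n.+1,
     upper_half_space x -> upper_half_space y ->
     rho_half_space x y <= u_metric (@upper_half_space R n) x y) /\
  ~ (exists C : R, C < 1 /\
       forall x y : 'rV[R]_n.+1,
         upper_half_space x -> upper_half_space y ->
         rho_half_space x y <= C * u_metric (@upper_half_space R n) x y).
Proof.
split=> [|[C [C1 HC]]]; first exact: rho_le_u_half_space.
have l0 : 0 < ln (2 : R) by rewrite ln_gt0// ltr1n.
(* For [0 <= C], the assumed bound gives [k <= C * (k + ln 2)], hence
   [k * (1 - C) <= C * ln 2 <= ln 2]; this [k] violates that. *)
pose k := (ln 2 + 1) / (1 - C).
have kE : k * (1 - C) = ln 2 + 1 by rewrite divfK// gt_eqF// subr_gt0.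
have k0 : 0 < k by rewrite divr_gt0 ?subr_gt0// addr_gt0.
have hx := @upper_half_space_axis R n _ (exprn_gt0 2 (expR_gt0 k)).
have hy := @upper_half_space_axis R n _ ltr01.
have := HC _ _ hx hy; have := rho_le_u_half_space _ _ _ _ hx hy.
have := @u_vertical_le R n k (ltW k0).
rewrite (rho_vertical _ _ _ (ltW k0)); set u := u_metric _ _ _ => uk ku kCu.
(* For negative [C], the lower bound [ku] makes [u] positive, so [C * u] is negative and cannot
   bound [2 * k]. *)
by have [C0|C0] := leP 0 C; nra.
Qed.
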